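(* Let $a,b\ge 1$ be integers, $m=a+b$, let $N\ge 1$ be an integer and $\alpha\in(0,1]$. Let $(Z_t(i))_{t\ge 0}$, $i=1,\dots,N$, and $(Z_t)_{t\ge 0}$ be, respectively, the fraction of red balls in urn $i$ and the total fraction of red balls in the interacting urn model with $N$ urns and parameter $\alpha$. Then for each $i=1,\dots,N$, almost surely the limits $\lim_{t\to+\infty}Z_t(i)$ and $\lim_{t\to+\infty}Z_t$ exist and $$\lim_{t\to+\infty}Z_t(i)=\lim_{t\to+\infty}Z_t .$$
   Context: Interacting urn model. Let $a,b\ge 1$ be integers (initial numbers of red and white balls in each urn), $m=a+b$, $N\ge 1$ the number of urns, and $\alpha\in[0,1]$. Let $\{U(t,i): t,i\in\mathbb{N}\}$ be i.i.d. random variables uniform on $[0,1]$, and $\mathcal{F}_t=\sigma(U(s,i): 0\le s\le t,\ i\in\mathbb{N})$. For $i=1,\dots,N$ set $X_0(i)=a$, $Z_0(i)=a/m$, and for $t\ge 0$ $$Z_t=\frac1N\sum_{j=1}^N Z_t(j),\qquad Y_t(i)=\mathbf{1}_{\{U(t+1,i)\le \alpha Z_t+(1-\alpha)Z_t(i)\}},$$ $$X_{t+1}(i)=X_t(i)+Y_t(i),\qquad Z_{t+1}(i)=\frac{X_{t+1}(i)}{t+1+m}=\frac{t+m}{t+m+1}Z_t(i)+\frac{1}{t+m+1}Y_t(i).$$ Thus $X_t(i)$ and $Z_t(i)$ are the number and fraction of red balls in urn $i$ at time $t$, and $Z_t$ is the total fraction of red balls. The dependence on $N$ is omitted from the notation.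 *)

(* Defs.v *)
From HB Require Import structures.
From mathcomp Require Export all_boot all_order all_algebra.
From mathcomp Require Export finmap all_classical all_reals all_analysis.

Set Implicit Arguments.
Unset Strict Implicit.
Unset Printing Implicit Defensive.

Import Order.TTheory GRing.Theory Num.Theory.
Import numFieldNormedType.Exports.

Local Open Scope classical_set_scope.
Local Open Scope ring_scope.

(* The product rule is required for every finite subfamily, not only pairwise. *)
Definition mutually_independent (I : choiceType) (d d' : measure_display)
    (T : measurableType d) (T' : measurableType d') (R : realType)
    (P : probability T R) (X : I -> {RV P >-> T'}) : Prop :=
  forall (J : {fset I}) (B : I -> set T'),
    (forall j, j \in J -> measurable (B j)) ->
    P (\bigcap_(j in [set` J]) (X j @^-1` B j)) =
    (\prod_(j <- J) P (X j @^-1` B j))%E.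

Definition uniform01 (d : measure_display) (T : measurableType d)
    (R : realType) (P : probability T R) (X : {RV P >-> R}) : Prop :=
  forall A : set R, measurable A ->
    distribution P X A = uniform_prob (@ltr01 R) A.

Section urn_model.
Context (R : realType) (a b N : nat) (alpha : R).

(* [x i] is a number of red balls in urn [i] at time [t], when every urn
   contains [t + (a + b)] balls. *)
Definition red_fraction (t : nat) (x : 'I_N -> nat) (i : 'I_N) : R :=
  (x i)%:R / (t + (a + b))%:R.

Definition total_red_fraction (t : nat) (x : 'I_N -> nat) : R :=
  N%:R^-1 * \sum_(j < N) red_fraction t x j.

(* The urns, numbered 1, ..., N, are indexed from 0 here: [i : 'I_N] stands for
   the urn [i.+1], which is driven by the variables [u t i.+1]. The boolean
   [u t i.+1 <= _] is coerced to 0 or 1. *)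
Definition red_drawn (u : nat -> nat -> R) (t : nat) (x : 'I_N -> nat)
    (i : 'I_N) : nat :=
  (u t.+1 i.+1 <=
     alpha * total_red_fraction t x + (1 - alpha) * red_fraction t x i)%R.

Fixpoint red_count (u : nat -> nat -> R) (t : nat) : 'I_N -> nat :=
  if t is s.+1 then
    fun i => (red_count u s i + red_drawn u s (red_count u s) i)%N
  else fun=> a.

Context (d : measure_display) (T : measurableType d) (P : probability T R).
Context (U : nat -> nat -> {RV P >-> R}).

Definition X (t : nat) (i : 'I_N) (w : T) : nat :=
  red_count (fun s k => U s k w) t i.

Definition Zurn (t : nat) (i : 'I_N) (w : T) : R :=
  red_fraction t (fun j => X t j w) i.

Definition Ztot (t : nat) (w : T) : R :=
  total_red_fraction t (fun j => X t j w).

Definition Y (t : nat) (i : 'I_N) (w : T) : nat :=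
  (U t.+1 i.+1 w <= alpha * Ztot t w + (1 - alpha) * Zurn t i w)%R.

Lemma X0 i w : X 0 i w = a.
Proof. by []. Qed.

Lemma XS t i w : X t.+1 i w = (X t i w + Y t i w)%N.
Proof. by []. Qed.

Lemma ZurnE t i w : Zurn t i w = (X t i w)%:R / (t + (a + b))%:R.
Proof. by []. Qed.

Lemma ZurnS t i w : (0 < a + b)%N ->
  Zurn t.+1 i w =
    (t + (a + b))%:R / (t + (a + b)).+1%:R * Zurn t i w
    + (t + (a + b)).+1%:R^-1 * (Y t i w)%:R.
Proof.
move=> m0; rewrite !ZurnE XS addSn.
have h : (t + (a + b))%:R != 0 :> R by rewrite pnatr_eq0 -lt0n addn_gt0 m0 orbT.
rewrite natrD mulrDl (mulrC (Y t i w)%:R) mulrAC; congr (_ + _).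
by rewrite [in RHS]mulrCA mulfV // mulr1.
Qed.

Lemma ZtotE t w : Ztot t w = N%:R^-1 * \sum_(j < N) Zurn t j w.
Proof. by []. Qed.

End urn_model.

(* Main.v *)
Require Import Defs.
From mathcomp Require Import measurable_realfun ring lra zify.

(** Why the theorem holds. Write [q t = 1 / (t + a + b + 1)].

    The total fraction of red balls moves by [q t] times a centred noise: the
    average over the urns of the probabilities of drawing red is the total
    fraction itself ([Ztot_increment]). It is thus a martingale with steps at
    most [q t], and orthogonality of its increments gives
    [E (Ztot (r + n) - Ztot r) ^ 2 <= n / (r + 1) ^ 2]
    ([expectation_Ztot_sqr_le]). Along the cubes this makes
    [\sum_k (k + 1) ^ 2 * (Ztot ((k + 1) ^ 3) - Ztot (k ^ 3)) ^ 2] integrable,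
    hence almost surely finite ([ae_cvg_series]), so that [Ztot] converges along
    the cubes; between two consecutive cubes it hardly moves, whatever the
    draws ([cvg_along_cubes]).

    The deviation [D t = Zurn t i - Ztot t] satisfies
    [D (t + 1) = (1 - alpha * q t) * D t + q t * noise], so
    [E (D (t + 1)) ^ 2 <= (1 - 2 * alpha * q t) * E (D t) ^ 2 + 4 * (q t) ^ 2]
    ([expectation_deviation_sqr_le]). Summing over [t] and using [alpha > 0],
    [\sum_t q t * (D t) ^ 2] is integrable, hence almost surely finite. As the
    steps of [D] are O(1/t), this forces [D] to tend to 0
    ([cvg0_summable_sqr_harmonic]), and [Zurn t i = Ztot t + D t] has the same
    limit as [Ztot t].

    The only probabilistic input is that the noise at time [t] is orthogonal to
    every function of the earlier draws ([expectation_draw]). There are finitely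
    many possible histories of draws, and the event that a given history occurs
    is an intersection of conditions on single uniform variables
    ([same_drawsE]); the product rule then applies directly. *)

Set Implicit Arguments.
Unset Strict Implicit.
Unset Printing Implicit Defensive.

Import Order.TTheory GRing.Theory Num.Theory.
Import numFieldNormedType.Exports.

Local Open Scope classical_set_scope.
Local Open Scope ring_scope.

(** * Convergence of deterministic sequences *)

Lemma cvg_summable_increments (R : realType) (u v : R^nat) :
  (forall n, `|u n.+1 - u n| <= v n) -> cvgn (series v) -> cvgn u.
Proof.
move=> uv cv.
have : cvgn (series (telescope u)).
  apply/normed_cvg/(series_le_cvg _ _ _ cv) => n.
  - exact: normr_ge0.
  - exact: le_trans (normr_ge0 _) (uv n).
  - exact: uv.
move=> ct; rewrite (_ : u = (fun n => u 0%N + series (telescope u) n)).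
  by apply: is_cvgD => //; exact: is_cvg_cst.
by apply/funext => n; rewrite -eq_sum_telescope.
Qed.

Lemma sum_inv_sqr_le2 (R : realType) (n : nat) :
  \sum_(k < n) (k.+1%:R ^- 2 : R) <= 2.
Proof.
have : \sum_(k < n) (k.+1%:R ^- 2 : R) <= 2 - 2 / n.+1%:R.
  elim: n => [|n IH]; first by rewrite big_ord0 divr1 subrr.
  rewrite big_ord_recr /=; apply: le_trans (lerD IH (lexx _)) _.
  have n0 : 0 <= n%:R :> R by exact: ler0n.
  have e1 : n.+1%:R = n%:R + 1 :> R by rewrite -natr1.
  have e2 : n.+2%:R = n%:R + 2 :> R by rewrite -(natrD _ n 2%N) addn2.
  rewrite e1 e2 -subr_ge0.
  have -> : 2 - 2 / (n%:R + 2) - (2 - 2 / (n%:R + 1) + (n%:R + 1) ^- 2) =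
     n%:R / ((n%:R + 2) * (n%:R + 1) ^+ 2) :> R.
    by field; rewrite !gt_eqF//; lra.
  by rewrite divr_ge0// mulr_ge0 ?sqr_ge0//; lra.
move=> /le_trans; apply.
by rewrite lerBlDr lerDl divr_ge0.
Qed.

Lemma cvg_series_inv_sqr (R : realType) :
  cvgn (series (fun k => k.+1%:R ^- 2 : R)).
Proof.
apply: nondecreasing_is_cvgn.
  by apply: nondecreasing_series => n _ _; rewrite invr_ge0 sqr_ge0.
exists 2 => _ [n _ <-]; rewrite /series /= big_mkord; exact: sum_inv_sqr_le2.
Qed.

Lemma dist_increments_le (R : realType) (M : R^nat) (r n : nat) :
  (forall t, `|M t.+1 - M t| <= t.+1%:R^-1) ->
  `|M (r + n)%N - M r| <= n%:R / r.+1%:R.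
Proof.
move=> dM; elim: n => [|n IH]; first by rewrite addn0 subrr normr0 mul0r.
rewrite (_ : _ - _ = (M (r + n).+1 - M (r + n)%N) + (M (r + n)%N - M r)); last first.
  by rewrite addnS; ring.
apply: le_trans (ler_normD _ _) _.
rewrite -natr1 addrC mulrDl mul1r; apply: lerD => //.
apply: le_trans (dM _) _.
by rewrite lef_pV2 ?posrE ?ltr0n// ler_nat ltnS leq_addr.
Qed.

(** The gap between consecutive cubes is at most [3 * k.+1 ^ 2], while
    [k.+1 ^ 3 <= 4 * (k ^ 3).+1]; hence the constants [12 = 3 * 4] here and
    [48 = 3 * 4 ^ 2] in the next bound. *)
Lemma cube_block_le (R : realType) (k n : nat) :
  (k ^ 3 + n <= k.+1 ^ 3)%N -> n%:R / (k ^ 3).+1%:R <= 12 / k.+1%:R :> R.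
Proof.
move=> h.
have h1 : (n <= 3 * k.+1 ^ 2)%N by nia.
have h2 : (k.+1 ^ 3 <= 4 * (k ^ 3).+1)%N by nia.
rewrite ler_pdivrMr ?ltr0n// mulrAC ler_pdivlMr ?ltr0n//.
rewrite -!natrM ler_nat; nia.
Qed.

Lemma cube_block_sqr_le (R : realType) (k n : nat) :
  (k ^ 3 + n <= k.+1 ^ 3)%N ->
  k.+1%:R ^+ 2 * (n%:R / (k ^ 3).+1%:R ^+ 2) <= 48 * k.+1%:R ^- 2 :> R.
Proof.
move=> h.
have h1 : (n <= 3 * k.+1 ^ 2)%N by nia.
have h2 : (k.+1 ^ 3 <= 4 * (k ^ 3).+1)%N by nia.
rewrite mulrA ler_pdivrMr ?exprn_gt0 ?ltr0n//.
rewrite (mulrAC 48) ler_pdivlMr ?exprn_gt0 ?ltr0n//.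
rewrite -!natrX -!natrM ler_nat.
have h3 : (k.+1 ^ 3 * k.+1 ^ 3 <= (4 * (k ^ 3).+1) * (4 * (k ^ 3).+1))%N.
  exact: leq_mul.
nia.
Qed.

(** Cubes are sparse enough for the weighted squares of the block increments
    to have a summable expectation when [M] is the martingale below, and dense
    enough for a sequence with steps at most [t.+1^-1] to move by only
    O(1/k) inside the [k]-th block, whatever happens there. The weight
    [k.+1 ^ 2] lets AM-GM pass from squares to absolute values:
    [|x| <= k.+1 ^ 2 * x ^ 2 + k.+1 ^- 2]. *)
Lemma cvg_along_cubes (R : realType) (M : R^nat) :
  (forall t, `|M t.+1 - M t| <= t.+1%:R^-1) ->
  cvgn (series (fun k => k.+1%:R ^+ 2 * (M (k.+1 ^ 3)%N - M (k ^ 3)%N) ^+ 2)) ->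
  cvgn M.
Proof.
move=> dM cs.
have cc : cvgn (fun k => M (k ^ 3)%N).
  apply: (@cvg_summable_increments _ _ (fun k =>
    k.+1%:R ^+ 2 * (M (k.+1 ^ 3)%N - M (k ^ 3)%N) ^+ 2 + k.+1%:R ^- 2)); last first.
    rewrite (_ : series _ =
        series (fun k => k.+1%:R ^+ 2 * (M (k.+1 ^ 3)%N - M (k ^ 3)%N) ^+ 2) \+
        series (fun k => k.+1%:R ^- 2)).
      by apply: is_cvgD => //; exact: cvg_series_inv_sqr.
    by apply/funext => n; rewrite /series /= big_split.
  move=> k /=; set x := M _ - M _.
  have k0 : 0 < k.+1%:R :> R by rewrite ltr0n.
  rewrite -[x ^+ 2]real_normK ?num_real//.
  rewrite -subr_ge0 (_ : _ - _ =
    (k.+1%:R * `|x| - k.+1%:R^-1) ^+ 2 + `|x|); last by field; rewrite gt_eqF.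
  by rewrite addr_ge0 ?sqr_ge0.
pose L := limn (fun k => M (k ^ 3)%N).
apply/cvg_ex; exists L.
apply/cvgrPdist_lt => e e0.
have /cvgrPdist_lt /(_ _ (divr_gt0 e0 (ltr0n _ 2))) [K1 _ HK1] :
  (fun k => M (k ^ 3)%N) @ \oo --> L by exact: cc.
have [K2 HK2] : exists K, forall k, (K <= k)%N -> 12 / k.+1%:R < e / 2.
  exists (Num.truncn (24 / e)) => k; rewrite -ltnS => hk.
  have : 24 / e < k.+1%:R.
    apply: lt_le_trans (truncnS_gt _) _; by rewrite ler_nat.
  by rewrite ltr_pdivrMr// => h; rewrite ltr_pdivrMr ?ltr0n//; lra.
pose K := maxn K1 K2.
exists (K ^ 3)%N => // n /= Kn.
have [k /andP[kn nk]] : exists k, (k ^ 3 <= n < k.+1 ^ 3)%N.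
  elim: n {Kn} => [|n [k /andP[kn nk]]]; first by exists 0%N.
  have [h|h] := ltnP n.+1 (k.+1 ^ 3)%N; first by exists k; rewrite h (leq_trans kn).
  by exists k.+1; rewrite h /=; nia.
have Kk : (K <= k)%N.
  by rewrite -ltnS -(ltn_exp2r _ _ (isT : (0 < 3)%N)); exact: leq_ltn_trans nk.
have nE : n = (k ^ 3 + (n - k ^ 3))%N by rewrite subnKC.
have h1 : `|M n - M (k ^ 3)%N| < e / 2.
  rewrite {1}nE; apply: le_lt_trans (dist_increments_le _ _ dM) _.
  apply: le_lt_trans (HK2 k _).
    by apply: cube_block_le; rewrite -nE ltnW.
  exact: leq_trans (leq_maxr _ _) Kk.
have /= h2 := HK1 k (leq_trans (leq_maxl _ _) Kk).
rewrite (_ : L - M n = (L - M (k ^ 3)%N) - (M n - M (k ^ 3)%N)); last by ring.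
apply: le_lt_trans (ler_normB _ _) _; lra.
Qed.

Lemma dvg_series_shifted_harmonic (R : realType) (m : nat) :
  ~ cvgn (series (fun t => (t + m).+1%:R^-1 : R)).
Proof.
move=> h; apply: (@dvg_harmonic R).
rewrite -(is_cvg_series_restrict m).
suff -> : (fun n => \sum_(m <= k < n) harmonic k) =
  (fun n => series (fun t => (t + m).+1%:R^-1 : R) (n - m)%N).
  apply/cvg_ex; exists (limn (series (fun t => (t + m).+1%:R^-1 : R))).
  exact: (cvg_comp _ _ (cvg_subnr m) h).
apply/funext => n; rewrite /series /=.
by rewrite -{1}(add0n m) big_addn.
Qed.

(** Summability of [D t ^ 2 / t] alone does not force [D] to vanish, but small
    steps do. The increments of [D ^ 3] are at most a multiple of
    [D t ^ 2 / t + t ^- 2], so they are absolutely summable and [D ^ 3]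
    converges; a nonzero limit would bound [D t ^ 2 / t] from below by a
    multiple of the harmonic series. *)
Lemma cvg0_summable_sqr_harmonic (R : realType) (m : nat) (D : R^nat) :
  (forall t, `|D t.+1 - D t| <= 2 / (t + m).+1%:R) ->
  cvgn (series (fun t => D t ^+ 2 / (t + m).+1%:R)) ->
  D @ \oo --> 0.
Proof.
move=> dD cs.
have cc : cvgn (fun t => D t ^+ 3).
  apply: (@cvg_summable_increments _ _ (fun t =>
    9 * (D t ^+ 2 / (t + m).+1%:R) + 24 * t.+1%:R ^- 2)); last first.
    rewrite (_ : series _ = (fun n => 9 * series (fun t => D t ^+ 2 / (t + m).+1%:R) n) \+
       (fun n => 24 * series (fun k => k.+1%:R ^- 2) n)).
      by apply: is_cvgD; apply: is_cvgM => //;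
        by [exact: is_cvg_cst|exact: cvg_series_inv_sqr].
    by apply/funext => n; rewrite /series /= big_split !mulr_sumr.
  move=> t; set x := D t; set y := D t.+1; set q := (t + m).+1%:R^-1.
  have q0 : 0 < q by rewrite invr_gt0 ltr0n.
  have q1 : q <= 1 by rewrite invf_le1 ?ltr0n// ler1n.
  have qt : q ^+ 2 <= t.+1%:R ^- 2.
    rewrite /q -exprVn; apply: lerXn2r; rewrite ?nnegrE ?invr_ge0 ?ler0n//.
    by rewrite lef_pV2 ?posrE ?ltr0n// ler_nat ltnS leq_addr.
  have dq : `|y - x| <= 2 * q by exact: dD.
  have h1 : `|y ^+ 3 - x ^+ 3| <= 2 * q * (y ^+ 2 + y * x + x ^+ 2).
    have p0 : 0 <= y ^+ 2 + y * x + x ^+ 2 by nra.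
    rewrite (_ : _ - _ = (y - x) * (y ^+ 2 + y * x + x ^+ 2)); last by ring.
    by rewrite normrM (ger0_norm p0) ler_wpM2r.
  have h2 : y ^+ 2 + y * x + x ^+ 2 <= 9 / 2 * x ^+ 2 + 12 * q.
    have dq2 : (y - x) ^+ 2 <= 4 * q ^+ 2.
      rewrite -real_normK ?num_real// (_ : 4 * q ^+ 2 = (2 * q) ^+ 2); last by ring.
      by rewrite lerXn2r ?nnegrE//; lra.
    have xd := sqr_ge0 (x - (y - x)).
    have qq : q ^+ 2 <= q by rewrite expr2 ler_piMr// ltW.
    by nra.
  apply: le_trans h1 _.
  apply: le_trans (ler_wpM2l _ h2) _; first lra.
  rewrite mulrDr; apply: lerD; first by lra.
  rewrite (_ : 2 * q * (12 * q) = 24 * q ^+ 2); last by ring.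
  by rewrite ler_pM2l.
have c0 : limn (fun t => D t ^+ 3) = 0.
  apply/eqP/negP => /negP l0.
  set l := limn _ in l0.
  have /cvgrPdist_lt : (fun t => D t ^+ 3) @ \oo --> l by exact: cc.
  have l2 : 0 < `|l| / 2 by rewrite divr_gt0 ?normr_gt0.
  move=> /(_ _ l2) [K _ HK].
  pose e := Num.min 1 (`|l| / 2).
  have e0 : 0 < e by rewrite lt_min ltr01.
  have He t : (K <= t)%N -> e <= D t ^+ 2.
    move=> /HK /= h.
    have : `|l| / 2 < `|D t| ^+ 3.
      rewrite -normrX; have := lerB_dist l (l - D t ^+ 3).
      rewrite (_ : l - (l - D t ^+ 3) = D t ^+ 3); last by ring.
      lra.
    move=> h3; rewrite -real_normK ?num_real//.
    have [d1|d1] := leP 1 `|D t|.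
      rewrite ge_min; apply/orP; left; exact: exprn_ege1.
    rewrite ge_min; apply/orP; right.
    apply: le_trans (ltW h3) _.
    by rewrite exprSr ler_piMr ?exprn_ge0 ?normr_ge0 ?ltW.
  apply: (@dvg_series_shifted_harmonic R m).
  (* The minorant [e / t] of the summands is only available from [K] on. *)
  pose v t : R := if (K <= t)%N then (t + m).+1%:R^-1 else 0.
  have cv : cvgn (series v).
    apply: (@series_le_cvg _ _ (fun t => e^-1 * (D t ^+ 2 / (t + m).+1%:R))).
    - by move=> t; rewrite /v; case: ifP.
    - by move=> t; rewrite mulr_ge0 ?invr_ge0 ?divr_ge0 ?sqr_ge0 ?ltW.
    - move=> t; rewrite /v; case: ifP => [Kt|_]; last first.
        by rewrite mulr_ge0 ?invr_ge0 ?divr_ge0 ?sqr_ge0 ?ltW.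
      rewrite mulrA ler_peMl ?invr_ge0//.
      by rewrite ler_pdivlMl// mulr1 He.
    rewrite (_ : series _ =
        (fun n => e^-1 * series (fun t => D t ^+ 2 / (t + m).+1%:R) n)).
      by apply: is_cvgM => //; exact: is_cvg_cst.
    by apply/funext => n; rewrite /series /= mulr_sumr.
  rewrite -(is_cvg_series_restrict K).
  rewrite (_ : (fun n => _) = (fun n => \sum_(K <= k < n) v k)).
    by rewrite is_cvg_series_restrict.
  by apply/funext => n; apply: eq_big_nat => k /andP[Kk _]; rewrite /v Kk.
apply/cvgrPdist_lt => e e0.
have /cvgrPdist_lt /(_ (e ^+ 3) (exprn_gt0 _ e0)) [K _ HK] :
  (fun t => D t ^+ 3) @ \oo --> 0 by rewrite -c0.
exists K => // t /HK /=; rewrite !sub0r !normrN normrX.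
by rewrite ltr_pXn2r ?nnegrE ?normr_ge0 ?(ltW e0).
Qed.

(** * Integration and independence *)

Lemma Rintegral_sum (d : measure_display) (T : measurableType d) (R : realType)
    (mu : {measure set T -> \bar R}) (D : set T) (I : Type) (s : seq I)
    (f : I -> T -> R) :
  measurable D -> (forall i, mu.-integrable D (EFin \o f i)) ->
  \int[mu]_(x in D) (\sum_(i <- s) f i x) =
  \sum_(i <- s) \int[mu]_(x in D) f i x.
Proof.
move=> mD fi; rewrite /Rintegral.
under eq_integral do rewrite -sumEFin.
rewrite (integral_sum mD fi) -EFin_sum_fine// => i _.
exact: integrable_fin_num.
Qed.

(** By monotone convergence the sum of the series has a finite integral, so it
    is finite almost everywhere. *)
Lemma ae_cvg_series (d : measure_display) (T : measurableType d) (R : realType)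
    (mu : {measure set T -> \bar R}) (f : nat -> T -> R) (C : R) :
  (forall n x, 0 <= f n x) ->
  (forall n, mu.-integrable setT (EFin \o f n)) ->
  (forall n, \sum_(k < n) \int[mu]_x f k x <= C) ->
  {ae mu, forall x, cvgn (series (f ^~ x))}.
Proof.
move=> f0 fi fC.
have mf n : measurable_fun setT (fun x => (f n x)%:E) by case/integrableP: (fi n).
pose g x := (\sum_(0 <= n <oo) (f n x)%:E)%E.
have g0 x : (0 <= g x)%E by apply: nneseries_ge0 => n _ _; rewrite lee_fin.
have mg : measurable_fun setT g.
  apply: ge0_emeasurable_sum => //.
  by move=> n x _ _; rewrite lee_fin.
have gi : mu.-integrable setT g.
  apply/integrableP; split => //.
  under eq_integral do rewrite gee0_abs//.
  rewrite integral_nneseries//; last by move=> n x _; rewrite lee_fin.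
  apply: (@le_lt_trans _ _ C%:E); last exact: ltry.
  apply: lime_le.
    by apply: is_cvg_nneseries => n _ _; apply: integral_ge0 => x _; rewrite lee_fin.
  apply: nearW => n; rewrite big_mkord.
  rewrite (le_trans _ (_ : (\sum_(k < n) \int[mu]_x f k x)%:E <= C%:E)%E) ?lee_fin//.
  rewrite -sumEFin; apply: lee_sum => k _.
  rewrite /Rintegral fineK//; exact: (integrable_fin_num measurableT (fi k)).
apply: filterS (integrable_ae measurableT gi) => x /(_ Logic.I) gx.
apply: nondecreasing_is_cvgn.
  by apply: nondecreasing_series => n _ _; exact: f0.
exists (fine (g x)) => _ [n _ <-].
rewrite -lee_fin fineK// /series /= -sumEFin.
by apply: nneseries_lim_ge => k _ _; rewrite lee_fin.
Qed.

Lemma preimage_ray (T : Type) (R : realType) (f : T -> R) (c : R) :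
  f @^-1` `]-oo, c]%classic = [set w | f w <= c].
Proof. by apply/funext => w /=; rewrite in_itv. Qed.

Lemma uniform01_le (d : measure_display) (T : measurableType d) (R : realType)
    (P : probability T R) (V : {RV P >-> R}) (c : R) :
  uniform01 V -> 0 <= c <= 1 -> P [set w | V w <= c] = c%:E.
Proof.
move=> /(_ `]-oo, c]%classic (measurable_itv _)) hV /andP[c0 c1].
rewrite -preimage_ray [LHS]hV /uniform_prob integral_uniform_pdf.
rewrite (_ : _ `&` _ = `[0, c]%classic); last first.
  apply/seteqP; split => x /=; rewrite !in_itv /=.
    by move=> [-> /andP[-> _]].
  by move=> /andP[x0 xc]; rewrite xc x0 (le_trans xc).
rewrite (eq_integral (fun=> 1%E)); last first.
  move=> x; rewrite inE /= in_itv /= => /andP[x0 xc].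
  by rewrite /uniform_pdf x0 (le_trans xc c1) subr0 invr1.
rewrite integral_cst//= lebesgue_measure_itv /= lte_fin mul1e.
case: ltP => [_|cle0]; first by rewrite -EFinB subr0.
by have -> : c = 0 by apply/eqP; rewrite eq_le c0 cle0.
Qed.

(** An event that is a finite intersection of conditions on single variables is
    independent of one more variable: compare the product rules for [J] and
    for [J] with [j] added. *)
Lemma mutually_independent_setU1 (I : choiceType) (d d' : measure_display)
    (T : measurableType d) (T' : measurableType d') (R : realType)
    (P : probability T R) (V : I -> {RV P >-> T'}) (J : {fset I}) (j : I)
    (B : I -> set T') (A : set T') :
  mutually_independent V -> j \notin J ->
  (forall k, k \in J -> measurable (B k)) -> measurable A ->
  P ((\bigcap_(k in [set` J]) (V k @^-1` B k)) `&` V j @^-1` A) =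
  (P (\bigcap_(k in [set` J]) (V k @^-1` B k)) * P (V j @^-1` A))%E.
Proof.
move=> indV jJ mB mA; pose B' k := if k == j then A else B k.
have B'j : B' j = A by rewrite /B' eqxx.
have B'J k : k \in J -> B' k = B k.
  by rewrite /B'; case: eqP => // ->; rewrite (negPf jJ).
have mB' k : k \in (j |` J)%fset -> measurable (B' k).
  by rewrite !inE => /orP[/eqP ->|kJ]; rewrite ?B'j// B'J//; exact: mB.
have := indV _ _ mB'; rewrite big_fsetU1//= B'j => h.
have eqB k (kJ : k \in J) : P (V k @^-1` B' k) = P (V k @^-1` B k).
  by rewrite B'J.
rewrite (indV J B mB) muleC -(eq_big_seq _ eqB).
rewrite -h; congr (P _); apply/seteqP; split => w /=.
  move=> [wJ wA] k /=; rewrite !inE => /orP[/eqP ->|kJ]; first by rewrite B'j.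
  by rewrite B'J//; exact: wJ.
move=> wj; split; last by have := wj j; rewrite B'j; apply; rewrite /= !inE eqxx.
by move=> k /= kJ; have := wj k; rewrite B'J//; apply; rewrite /= !inE kJ orbT.
Qed.

(** * The draws before a given time *)

Section urns.
Context (R : realType) (d : measure_display) (T : measurableType d).
Context (P : probability T R) (a b N : nat) (alpha : R).
Context (U : nat -> nat -> {RV P >-> R}).

Local Notation Y := (Y a b alpha U).
Local Notation Zurn := (Zurn a b alpha U).
Local Notation Ztot := (Ztot a b N alpha U).

Definition red_proba (t : nat) (i : 'I_N) (w : T) : R :=
  alpha * Ztot t w + (1 - alpha) * Zurn t i w.

(** The atom containing [w] of the (finite) sigma-algebra generated by the draws
    before time [t]. The draws determine the composition of the urns, hence all
    the processes of the model. *)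
Definition same_draws (t : nat) (w : T) : set T := fun w' =>
  forall s (i : 'I_N), (s < t)%N -> Y s i w = Y s i w'.

(** Measurability with respect to the draws before time [t], stated as
    constancy on the atoms. *)
Definition adapted (t : nat) (f : T -> R) : Prop :=
  forall w w', same_draws t w w' -> f w = f w'.

Lemma same_drawsW s t w w' :
  (s <= t)%N -> same_draws t w w' -> same_draws s w w'.
Proof. by move=> st h r i rs; apply: h; exact: leq_trans st. Qed.

Lemma adaptedW s t f : (s <= t)%N -> adapted s f -> adapted t f.
Proof. by move=> st hf w w' /(same_drawsW st)/hf. Qed.

Lemma adapted_op t (op : R -> R -> R) f g :
  adapted t f -> adapted t g -> adapted t (fun w => op (f w) (g w)).
Proof. by move=> hf hg w w' ww'; rewrite (hf w w')// (hg w w'). Qed.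

Lemma adapted_fun t (h : R -> R) f :
  adapted t f -> adapted t (fun w => h (f w)).
Proof. by move=> hf w w' ww'; rewrite (hf w w'). Qed.

Lemma adapted_sum t (f : 'I_N -> T -> R) :
  (forall i, adapted t (f i)) -> adapted t (fun w => \sum_(i < N) f i w).
Proof. by move=> hf w w' ww'; apply: eq_bigr => i _; exact: hf. Qed.

Lemma adapted_Zurn t (i : 'I_N) : adapted t (Zurn t i).
Proof.
move=> w w' ww'; rewrite !ZurnE; congr (_%:R / _).
elim: t ww' => [//|t IH] ww'; rewrite !XS IH ?ww'//.
exact: same_drawsW ww'.
Qed.

Lemma adapted_Ztot t : adapted t (Ztot t).
Proof.
move=> w w' ww'; rewrite !ZtotE; congr (_ * _); apply: eq_bigr => i _.
exact: adapted_Zurn.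
Qed.

Lemma adapted_red_proba t (i : 'I_N) : adapted t (red_proba t i).
Proof.
by move=> w w' ww'; rewrite /red_proba (adapted_Ztot ww') (adapted_Zurn _ ww').
Qed.

Lemma adapted_Y t (i : 'I_N) : adapted t.+1 (fun w => (Y t i w)%:R).
Proof. by move=> w w' ww'; rewrite ww'. Qed.

Lemma YE t (i : 'I_N) w : Y t i w = (U t.+1 i.+1 w <= red_proba t i w)%R.
Proof. by []. Qed.

(** The values of the uniform variable number [p] that give the same draw as in
    the outcome [w0], when the urns are composed as in [w0]. Uniform variables
    are numbered from 1 in both coordinates, hence the predecessors. *)
Definition draw_event (w0 : T) (p : nat * nat) : set R :=
  if (insub p.2.-1 : option 'I_N) is Some i then
    [set u | (u <= red_proba p.1.-1 i w0)%R = (Y p.1.-1 i w0 == 1%N)]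
  else setT.

Definition past_indices (t : nat) : {fset nat * nat} :=
  [fset p in [seq (s.+1, k.+1) | s <- iota 0 t, k <- iota 0 N]]%fset.

Lemma past_indicesP t p :
  reflect (exists s (i : 'I_N), (s < t)%N /\ p = (s.+1, i.+1))
          (p \in past_indices t).
Proof.
rewrite inE /=; apply: (iffP allpairsP).
  move=> [[s k] /= []]; rewrite !mem_iota !add0n /= => st kN ->.
  by exists s, (Ordinal kN).
move=> [s [i [st ->]]]; exists (s, val i) => /=.
by rewrite !mem_iota !add0n /= st ltn_ord.
Qed.

Lemma measurable_draw_event w0 p : measurable (draw_event w0 p).
Proof.
rewrite /draw_event; case: insub => [i|//].
set c := red_proba _ _ _; case: (_ == _).
  rewrite (_ : [set _ | _] = `]-oo, c]%classic); first exact: measurable_itv.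
  by apply/funext => u /=; rewrite in_itv.
rewrite (_ : [set _ | _] = `]c, +oo[%classic); first exact: measurable_itv.
apply/seteqP; split => u /=; rewrite in_itv /= andbT ltNge; first by move=> ->.
by move=> /negbTE.
Qed.

(** As long as the draws agree with those of [w0], so do the compositions of the
    urns, hence the thresholds of the next draws. Thresholds can therefore be
    frozen at their value in [w0], which makes the atom a rectangle. *)
Lemma same_drawsE t w0 :
  same_draws t w0 =
  \bigcap_(p in [set` past_indices t]) (U p.1 p.2 @^-1` draw_event w0 p).
Proof.
apply/seteqP; split => w /=.
  move=> ww _ /= /past_indicesP[s [i [st ->]]].
  rewrite /= /draw_event /= valK /= (_ : red_proba s i w0 = red_proba s i w).
    by rewrite ww// YE; case: (_ <= _)%R.
  by apply/adapted_red_proba/(same_drawsW _ ww)/ltnW.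
elim: t => [//|t IH] h s i; rewrite ltnS => st.
have ww : same_draws s w0 w.
  apply: (same_drawsW st); apply: IH => p /= /past_indicesP[r [j [rt ->]]].
  by apply: h => /=; apply/past_indicesP; exists r, j; split => //; exact: ltnW.
have /= := h (s.+1, i.+1).
rewrite /draw_event /= valK /= (adapted_red_proba _ ww) => {}h.
rewrite [RHS]YE h; last by apply/past_indicesP; exists s, i.
by rewrite YE; case: (_ <= _)%R.
Qed.

Lemma measurable_same_draws t w0 : measurable (same_draws t w0).
Proof.
rewrite same_drawsE; apply: fin_bigcap_measurable; first exact: finite_fset.
move=> p _; rewrite -[_ @^-1` _]setTI.
by apply: measurable_funPT => //; exact: measurable_draw_event.
Qed.

Definition history (t : nat) (w : T) : {ffun 'I_t * 'I_N -> bool} :=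
  [ffun p : 'I_t * 'I_N => Y p.1 p.2 w == 1%N].

Lemma historyP t w w' : history t w = history t w' <-> same_draws t w w'.
Proof.
split => [/ffunP h s i st|h].
  by move: (h (Ordinal st, i)); rewrite !ffunE /= !YE; do 2 case: (_ <= _)%R.
by apply/ffunP => -[s i]; rewrite !ffunE /= h.
Qed.

Lemma history_fiber t w0 :
  history t @^-1` [set history t w0] = same_draws t w0.
Proof.
by apply/seteqP; split => w /= h; [apply/historyP|symmetry; apply/historyP].
Qed.

Lemma measurable_history_fiber t h : measurable (history t @^-1` [set h]).
Proof.
have [[w <-]|nh] := pselect (exists w, history t w = h).
  by rewrite history_fiber; exact: measurable_same_draws.
rewrite (_ : _ @^-1` _ = set0)//; apply/seteqP; split => // w /= wh.
by apply: nh; exists w.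
Qed.

(** Histories range over a finite type, so that an adapted function is a finite
    combination of indicators. *)
Lemma adapted_decomposition t f : adapted t f ->
  exists v : {ffun 'I_t * 'I_N -> bool} -> R,
    forall w, f w = v (history t w).
Proof.
move=> ft.
have /choice[v hv] : forall h : {ffun 'I_t * 'I_N -> bool}, exists r,
    forall w, history t w = h -> f w = r.
  move=> h; have [[w0 <-]|nh] := pselect (exists w, history t w = h).
    by exists (f w0) => w /historyP; exact: ft.
  by exists 0 => w wh; case: nh; exists w.
by exists v => w; exact: hv.
Qed.

Lemma sum_history_fibers t w (v : {ffun 'I_t * 'I_N -> bool} -> R) :
  \sum_h v h * \1_(history t @^-1` [set h]) w = v (history t w).
Proof.
rewrite (bigD1 (history t w)) //= indicE mem_set//= mulr1 big1 ?addr0// => h hw.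
rewrite indicE memNset ?mulr0//= => wh.
by rewrite wh eqxx in hw.
Qed.

Lemma integrable_adapted t f : adapted t f -> P.-integrable setT (EFin \o f).
Proof.
move=> /adapted_decomposition[v hv].
rewrite (_ : EFin \o f = fun w =>
  (\sum_(h <- index_enum _) (v h)%:E * (\1_(history t @^-1` [set h]) w)%:E)%E).
  apply: integrable_sum => // h _; apply: integrableZl => //.
  exact/integrable_indic/measurable_history_fiber.
apply/funext => w /=; rewrite hv -sum_history_fibers -sumEFin.
by apply: eq_bigr => h _; rewrite EFinM.
Qed.

(** * Expectations of adapted functions *)

Lemma expectation_cst (c : R) : \int[P]_w c = c.
Proof.
rewrite Rintegral_cst// -[RHS]mulr1; congr (_ * _).
exact: (congr1 fine (probability_setT P)).
Qed.

Lemma le_expectation_adapted t f g : adapted t f -> adapted t g ->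
  (forall w, f w <= g w) -> \int[P]_w f w <= \int[P]_w g w.
Proof.
by move=> ft gt fg; apply: le_Rintegral => //;
  [exact: integrable_adapted ft|exact: integrable_adapted gt].
Qed.

Lemma expectation_adaptedD t f g : adapted t f -> adapted t g ->
  \int[P]_w (f w + g w) = \int[P]_w f w + \int[P]_w g w.
Proof.
by move=> ft gt; rewrite RintegralD//;
  [exact: integrable_adapted ft|exact: integrable_adapted gt].
Qed.

Lemma expectation_adaptedZ t c f : adapted t f ->
  \int[P]_w (c * f w) = c * \int[P]_w f w.
Proof. by move=> ft; rewrite RintegralZl//; exact: integrable_adapted ft. Qed.

Lemma expectation_adapted_sum t (f : 'I_N -> T -> R) :
  (forall i, adapted t (f i)) ->
  \int[P]_w (\sum_(i < N) f i w) = \sum_(i < N) \int[P]_w f i w.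
Proof. by move=> ft; rewrite Rintegral_sum// => i; exact: integrable_adapted (ft i). Qed.

Context (a_gt0 : (0 < a)%N) (N_gt0 : (0 < N)%N) (alpha01 : 0 <= alpha <= 1).
Context (indU : mutually_independent (fun ti : nat * nat => U ti.1 ti.2)).
Context (unifU : forall t i : nat, uniform01 (U t i)).

Lemma Zurn_itv t (i : 'I_N) w : 0 <= Zurn t i w <= 1.
Proof.
have Xt : (X a b alpha U t i w <= t + a)%N.
  elim: t => [//|t IH]; rewrite XS addSn -addn1 leq_add//.
  by rewrite YE; case: (_ <= _)%R.
rewrite ZurnE divr_ge0//= ler_pdivrMr ?ltr0n ?addn_gt0 ?a_gt0 ?orbT//.
by rewrite mul1r ler_nat (leq_trans Xt)// addnA leq_addr.
Qed.

Lemma Ztot_itv t w : 0 <= Ztot t w <= 1.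
Proof.
rewrite ZtotE; apply/andP; split.
  rewrite mulr_ge0 ?invr_ge0// sumr_ge0// => i _.
  by have /andP[] := Zurn_itv t i w.
rewrite ler_pdivrMl ?ltr0n// mulr1.
rewrite -[leRHS](_ : \sum_(i < N) 1 = _).
  by apply: ler_sum => i _; have /andP[] := Zurn_itv t i w.
by rewrite sumr_const card_ord.
Qed.

Lemma red_proba_itv t (i : 'I_N) w : 0 <= red_proba t i w <= 1.
Proof.
have /andP[? ?] := Zurn_itv t i w; have /andP[? ?] := Ztot_itv t w.
have /andP[? ?] := alpha01.
by rewrite /red_proba; apply/andP; split; nra.
Qed.

(** The threshold is constant on the atom, and the next uniform variable is not
    among those that define the atom. *)
Lemma prob_red_draw t (i : 'I_N) w0 :
  P (same_draws t w0 `&` [set w | U t.+1 i.+1 w <= red_proba t i w0]) =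
  (P (same_draws t w0) * (red_proba t i w0)%:E)%E.
Proof.
have mc := measurable_itv (`]-oo, red_proba t i w0]).
rewrite -(uniform01_le (unifU t.+1 i.+1) (red_proba_itv t i w0)).
rewrite -preimage_ray same_drawsE.
have := @mutually_independent_setU1 _ _ _ _ _ _ _ _ (past_indices t) (t.+1, i.+1)
  (draw_event w0) _ indU _ _ mc; apply.
  by apply/negP => /past_indicesP[s [j [st [ts _]]]]; rewrite ts ltnn in st.
by move=> k _; exact: measurable_draw_event.
Qed.

(** The martingale property: [red_proba t i] is the conditional probability of a
    red draw given the past, a property expressed by testing against adapted
    functions. On each atom it reduces to [prob_red_draw]. *)
Lemma expectation_draw t (i : 'I_N) f : adapted t f ->
  \int[P]_w (f w * ((Y t i w)%:R - red_proba t i w)) = 0.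
Proof.
move=> ft; have [v hv] := adapted_decomposition ft.
pose g w := (Y t i w)%:R - red_proba t i w.
have gt : adapted t.+1 g.
  apply: (@adapted_op t.+1 (fun x y => x - y)); first exact: adapted_Y.
  exact/(adaptedW (leqnSn t))/adapted_red_proba.
have indt h : adapted t (\1_(history t @^-1` [set h])).
  move=> w w' /historyP ww'; rewrite !indicE; congr ((nat_of_bool _)%:R).
  by apply/idP/idP; rewrite !inE /= ww'.
have indgt h : adapted t.+1 (fun w => \1_(history t @^-1` [set h]) w * g w).
  by apply: (@adapted_op t.+1 (fun x y => x * y)) => //; exact: adaptedW (indt h).
rewrite (_ : (fun w => _) = fun w => \sum_(h <- index_enum {ffun 'I_t * 'I_N -> bool})
    v h * (\1_(history t @^-1` [set h]) w * g w)); last first.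
  apply/funext => w; rewrite hv -sum_history_fibers mulr_suml.
  by apply: eq_bigr => h _; rewrite mulrA.
rewrite Rintegral_sum//; last first.
  move=> h; apply: (@integrable_adapted t.+1).
  exact: (@adapted_fun _ (fun x => v h * x)).
rewrite big1 // => h _; rewrite (expectation_adaptedZ _ (indgt h)).
have [[w0 <-]|nh] := pselect (exists w, history t w = h); last first.
  rewrite (_ : (fun w => _) = fun=> 0); first by rewrite expectation_cst mulr0.
  apply/funext => w; rewrite indicE memNset ?mul0r//= => wh.
  by apply: nh; exists w.
rewrite history_fiber.
have mA := measurable_same_draws t w0.
have mB : measurable (same_draws t w0 `&` [set w | U t.+1 i.+1 w <= red_proba t i w0]).
  apply: measurableI => //; rewrite -preimage_ray -[_ @^-1` _]setTI.
  by apply: measurable_funPT => //; exact: measurable_itv.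
rewrite (_ : (fun w => _) = fun w =>
    \1_(same_draws t w0 `&` [set w | U t.+1 i.+1 w <= red_proba t i w0]) w -
    red_proba t i w0 * \1_(same_draws t w0) w); last first.
  apply/funext => w; rewrite indicI /= !indicE.
  have [/set_mem ww|_] := boolP (w \in same_draws t w0); last first.
    by rewrite /= !mulr0n !mul0r mulr0 subr0.
  rewrite /= !mulr1n !mul1r mulr1 /g YE -(adapted_red_proba i ww).
  suff -> : (w \in [set w | U t.+1 i.+1 w <= red_proba t i w0]) =
    (U t.+1 i.+1 w <= red_proba t i w0) by [].
  by apply/idP/idP; rewrite inE.
rewrite RintegralB//; last 2 first.
- exact: integrable_indic.
- exact: (integrableZl measurableT (red_proba t i w0) (integrable_indic P mA)).
rewrite RintegralZl//; last exact: integrable_indic.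
rewrite /Rintegral !integral_indic// !setIT.
apply/eqP; rewrite mulf_eq0 subr_eq0; apply/orP; right; apply/eqP.
have := congr1 fine (prob_red_draw t i w0).
rewrite fineM//=; last exact: fin_num_measure.
by rewrite mulrC.
Qed.

(** * Increments of the fractions of red balls *)

Definition mean_noise (t : nat) (w : T) : R :=
  N%:R^-1 * \sum_(j < N) ((Y t j w)%:R - red_proba t j w).

Definition step_size (t : nat) : R := (t + (a + b)).+1%:R^-1.

Lemma step_size_ge0 t : 0 <= step_size t. Proof. by rewrite invr_ge0. Qed.

Lemma step_size_le t : step_size t <= t.+1%:R^-1.
Proof. by rewrite lef_pV2 ?posrE ?ltr0n// ler_nat ltnS leq_addr. Qed.

Lemma Zurn_increment t (i : 'I_N) w :
  Zurn t.+1 i w = Zurn t i w + step_size t * ((Y t i w)%:R - Zurn t i w).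
Proof.
rewrite ZurnS ?addn_gt0 ?a_gt0// /step_size -natr1.
have q0 : (t + (a + b))%:R + 1 != 0 :> R by rewrite natr1.
by field.
Qed.

(** The interaction preserves the mean: the average over the urns of
    [red_proba t] is [Ztot t], so that [Ztot] has no drift. *)
Lemma Ztot_increment t w : Ztot t.+1 w = Ztot t w + step_size t * mean_noise t w.
Proof.
rewrite !ZtotE /mean_noise.
under eq_bigr do rewrite Zurn_increment.
rewrite big_split /= -mulr_sumr mulrDr; congr (_ + _).
rewrite mulrCA; congr (_ * (_ * _)).
rewrite !sumrB; congr (_ - _).
have N0 : N%:R != 0 :> R by rewrite pnatr_eq0 -lt0n.
rewrite [RHS](_ : _ =
    N%:R * (alpha * Ztot t w) + (1 - alpha) * \sum_(j < N) Zurn t j w).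
  by rewrite ZtotE; field.
by rewrite /red_proba big_split /= sumr_const card_ord mulr_natl mulr_sumr.
Qed.

Lemma Y_itv t (i : 'I_N) w : 0 <= ((Y t i w)%:R : R) <= 1.
Proof. by rewrite ler0n lern1 YE leq_b1. Qed.

Lemma Zurn_increment_le t (i : 'I_N) w :
  `|Zurn t.+1 i w - Zurn t i w| <= step_size t.
Proof.
rewrite Zurn_increment addrAC subrr add0r normrM ger0_norm ?step_size_ge0//.
rewrite ler_piMr ?step_size_ge0// ler_norml.
have /andP[? ?] := Y_itv t i w; have /andP[? ?] := Zurn_itv t i w.
by apply/andP; split; lra.
Qed.

Lemma Ztot_increment_le t w : `|Ztot t.+1 w - Ztot t w| <= step_size t.
Proof.
rewrite !ZtotE -mulrBr -sumrB normrM ger0_norm ?invr_ge0//.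
rewrite ler_pdivrMl ?ltr0n//; apply: le_trans (ler_norm_sum _ _ _) _.
rewrite mulr_natl -[X in _ <= _ *+ X]card_ord -sumr_const.
by apply: ler_sum => i _; exact: Zurn_increment_le.
Qed.

Lemma adapted_noise t (i : 'I_N) :
  adapted t.+1 (fun w => (Y t i w)%:R - red_proba t i w).
Proof.
apply: (@adapted_op t.+1 (fun x y => x - y)); first exact: adapted_Y.
exact/(adaptedW (leqnSn t))/adapted_red_proba.
Qed.

Lemma adapted_mean_noise t : adapted t.+1 (mean_noise t).
Proof.
apply: (@adapted_fun t.+1 (fun x => N%:R^-1 * x)).
by apply: adapted_sum => i; exact: adapted_noise.
Qed.

Lemma expectation_mean_noise t f : adapted t f ->
  \int[P]_w (f w * mean_noise t w) = 0.
Proof.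
move=> ft.
have fn (i : 'I_N) : adapted t.+1 (fun w => f w * ((Y t i w)%:R - red_proba t i w)).
  apply: (@adapted_op t.+1 (fun x y => x * y)); last exact: adapted_noise.
  exact: adaptedW (leqnSn t) ft.
under eq_Rintegral => w _ do rewrite mulrCA mulr_sumr.
rewrite (@expectation_adaptedZ t.+1); last by apply: adapted_sum.
rewrite (@expectation_adapted_sum t.+1)// big1 ?mulr0// => i _.
exact: expectation_draw.
Qed.

(** Increments of a martingale are orthogonal, so their second moments add up;
    each of the [n] steps contributes at most [r.+1 ^- 2]. *)
Lemma expectation_Ztot_sqr_le r n :
  \int[P]_w (Ztot (r + n) w - Ztot r w) ^+ 2 <= n%:R / r.+1%:R ^+ 2.
Proof.
elim: n => [|n IH].
  rewrite mul0r addn0; under eq_Rintegral do rewrite subrr expr0n.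
  by rewrite expectation_cst.
have At : adapted (r + n) (fun w => Ztot (r + n) w - Ztot r w).
  apply: (@adapted_op _ (fun x y => x - y)); first exact: adapted_Ztot.
  exact/(adaptedW (leq_addr n r))/adapted_Ztot.
set A := fun w => _ in At; pose q := step_size (r + n).
have qr : q ^+ 2 <= r.+1%:R ^- 2.
  rewrite -exprVn lerXn2r ?nnegrE ?invr_ge0 ?step_size_ge0//.
  apply: le_trans (step_size_le _) _.
  by rewrite lef_pV2 ?posrE ?ltr0n// ler_nat ltnS leq_addr.
have A2t : adapted (r + n) (fun w => A w ^+ 2 + q ^+ 2).
  exact: (@adapted_fun _ (fun x => x ^+ 2 + q ^+ 2)).
have Ant : adapted (r + n).+1 (fun w => A w * mean_noise (r + n) w).
  apply: (@adapted_op _ (fun x y => x * y)); last exact: adapted_mean_noise.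
  exact: adaptedW At.
have A2qt := adaptedW (leqnSn _) A2t.
have cAnt : adapted (r + n).+1 (fun w => 2 * q * (A w * mean_noise (r + n) w)).
  exact: (@adapted_fun _ (fun x => 2 * q * x)).
apply: (@le_trans _ _ (\int[P]_w ((A w ^+ 2 + q ^+ 2) +
    2 * q * (A w * mean_noise (r + n) w)))).
  apply: (@le_expectation_adapted (r + n).+1).
  - apply: (@adapted_fun _ (fun x => x ^+ 2)).
    apply: (@adapted_op _ (fun x y => x - y)).
      by rewrite addnS; exact: adapted_Ztot.
    apply: (@adaptedW r); last exact: adapted_Ztot.
    by rewrite (leq_trans (leq_addr n r)).
  - exact: (@adapted_op _ (fun x y => x + y)).
  - move=> w; have := Ztot_increment_le (r + n) w.
    rewrite addnS /A Ztot_increment -/q addrAC subrr add0r => dq.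
    have : (q * mean_noise (r + n) w) ^+ 2 <= q ^+ 2.
      by rewrite -real_normK ?num_real// lerXn2r ?nnegrE ?step_size_ge0.
    lra.
rewrite (expectation_adaptedD A2qt cAnt) (expectation_adaptedZ _ Ant).
rewrite expectation_mean_noise// mulr0 addr0.
rewrite (@expectation_adaptedD (r + n)) ?expectation_cst//; last first.
  exact: (@adapted_fun _ (fun x => x ^+ 2)).
by rewrite -natr1 mulrDl mul1r lerD.
Qed.

Definition deviation (i : 'I_N) (t : nat) (w : T) : R := Zurn t i w - Ztot t w.

Lemma adapted_deviation i t : adapted t (deviation i t).
Proof.
apply: (@adapted_op _ (fun x y => x - y)); last exact: adapted_Ztot.
exact: adapted_Zurn.
Qed.

Lemma deviation_increment_le i t w :
  `|deviation i t.+1 w - deviation i t w| <= 2 * step_size t.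
Proof.
rewrite /deviation.
rewrite (_ : _ - _ = (Zurn t.+1 i w - Zurn t i w) - (Ztot t.+1 w - Ztot t w)); 
  last by ring.
apply: le_trans (ler_normB _ _) _.
have := Zurn_increment_le t i w; have := Ztot_increment_le t w; lra.
Qed.

(** The interaction pulls each urn back to the average, at rate [alpha] times
    the step size. *)
Lemma deviation_increment i t w :
  deviation i t.+1 w = deviation i t w + step_size t *
    (((Y t i w)%:R - red_proba t i w) - mean_noise t w - alpha * deviation i t w).
Proof.
by rewrite /deviation Ztot_increment Zurn_increment /red_proba; ring.
Qed.

(** The noise is orthogonal to the deviation, so in the square of
    [deviation_increment] only the drift and the second-order term survive. *)
Lemma expectation_deviation_sqr_le i t :
  \int[P]_w deviation i t.+1 w ^+ 2
    + 2 * alpha * step_size t * \int[P]_w deviation i t w ^+ 2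
  <= \int[P]_w deviation i t w ^+ 2 + 4 * step_size t ^+ 2.
Proof.
set D := deviation i; pose q := step_size t.
have Dt : adapted t (D t) by exact: adapted_deviation.
have D2 s : adapted s (fun w => D s w ^+ 2).
  exact/(@adapted_fun _ (fun x => x ^+ 2))/adapted_deviation.
have Dm : adapted t.+1 (fun w => D t w * ((Y t i w)%:R - red_proba t i w)).
  apply: (@adapted_op t.+1 (fun x y => x * y)); last exact: adapted_noise.
  exact: adaptedW (leqnSn t) Dt.
have Dn : adapted t.+1 (fun w => D t w * mean_noise t w).
  apply: (@adapted_op t.+1 (fun x y => x * y)); last exact: adapted_mean_noise.
  exact: adaptedW (leqnSn t) Dt.
(* Pointwise majorant: the square of the increment is bounded by [4 * q ^ 2],
   the cross terms are kept as they are. *)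
pose c := 1 - 2 * alpha * q.
have : \int[P]_w D t.+1 w ^+ 2 <= \int[P]_w ((c * D t w ^+ 2 + 4 * q ^+ 2) +
  (2 * q * (D t w * ((Y t i w)%:R - red_proba t i w)) +
   - (2 * q) * (D t w * mean_noise t w))).
  apply: (@le_expectation_adapted t.+1).
  - exact: D2.
  - apply: (@adapted_op _ (fun x y => c * x ^+ 2 + 4 * q ^+ 2 + y)).
      exact: adaptedW Dt.
    exact: (@adapted_op _ (fun x y => 2 * q * x + - (2 * q) * y)).
  - move=> w; have := deviation_increment_le i t w.
    rewrite deviation_increment addrAC subrr add0r -/q -/(D t w).
    rewrite [D t.+1 w]deviation_increment -/q -/(D t w).
    set x := D t w; set y := _ - red_proba t i w; set z := mean_noise t w => dq.
    have : (q * (y - z - alpha * x)) ^+ 2 <= 4 * q ^+ 2.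
      rewrite (_ : 4 * q ^+ 2 = (2 * q) ^+ 2); last by ring.
      by rewrite -real_normK ?num_real// lerXn2r ?nnegrE// mulr_ge0// step_size_ge0.
    by rewrite /c; lra.
rewrite (@expectation_adaptedD t.+1); last 2 first.
- exact/(adaptedW (leqnSn t))/(@adapted_fun _ (fun x => c * x ^+ 2 + 4 * q ^+ 2)).
- exact: (@adapted_op _ (fun x y => 2 * q * x + - (2 * q) * y)).
rewrite (@expectation_adaptedD t (fun w => c * D t w ^+ 2)) ?expectation_cst//;
  last first.
  exact: (@adapted_fun _ (fun x => c * x ^+ 2)).
rewrite (@expectation_adaptedZ t)// (@expectation_adaptedD t.+1); last 2 first.
- exact: (@adapted_fun _ (fun x => 2 * q * x)).
- exact: (@adapted_fun _ (fun x => - (2 * q) * x)).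
rewrite (expectation_adaptedZ _ Dm) (expectation_adaptedZ _ Dn).
rewrite expectation_mean_noise// expectation_draw// !mulr0 !addr0.
rewrite /c -/q; lra.
Qed.

(** Telescoping the previous inequality: the total drift is paid for by the
    initial value, at most 1, and the second-order terms, at most [4 * 2]. *)
Lemma sum_expectation_deviation_sqr_le i n :
  \sum_(t < n) 2 * alpha * step_size t * \int[P]_w deviation i t w ^+ 2 <= 9.
Proof.
have h : \sum_(t < n) 2 * alpha * step_size t * \int[P]_w deviation i t w ^+ 2
    + \int[P]_w deviation i n w ^+ 2 <=
    1 + 4 * \sum_(t < n) t.+1%:R ^- 2.
  elim: n => [|n IH].
    rewrite !big_ord0 mulr0 addr0 add0r -[leRHS](expectation_cst 1).
    apply: (@le_expectation_adapted 0) => //.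
    move=> w; rewrite /deviation.
    have /andP[? ?] := Zurn_itv 0 i w; have /andP[? ?] := Ztot_itv 0 w; nra.
  rewrite !big_ord_recr /= mulrDr.
  have := expectation_deviation_sqr_le i n.
  have : step_size n ^+ 2 <= n.+1%:R ^- 2.
    by rewrite -exprVn lerXn2r ?nnegrE ?invr_ge0 ?step_size_ge0 ?step_size_le.
  move: IH; move: (n.+1%:R ^- 2 : R) (\sum_(k < n) k.+1%:R ^- 2 : R) => u v.
  lra.
have := sum_inv_sqr_le2 R n.
have : 0 <= \int[P]_w deviation i n w ^+ 2.
  by apply: Rintegral_ge0 => w _; exact: sqr_ge0.
lra.
Qed.

(** * Almost sure convergence *)

Lemma ae_cvg_Ztot : {ae P, forall w, cvgn (fun t => Ztot t w)}.
Proof.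
pose f k w := k.+1%:R ^+ 2 * (Ztot (k.+1 ^ 3) w - Ztot (k ^ 3) w) ^+ 2.
have k3 k : (k ^ 3 <= k.+1 ^ 3)%N by rewrite leq_exp2r.
have dt k : adapted (k.+1 ^ 3) (fun w => (Ztot (k.+1 ^ 3) w - Ztot (k ^ 3) w) ^+ 2).
  apply: (@adapted_op _ (fun x y => (x - y) ^+ 2)); first exact: adapted_Ztot.
  exact/(adaptedW (k3 k))/adapted_Ztot.
have ft k : adapted (k.+1 ^ 3) (f k).
  exact: (@adapted_fun _ (fun x => k.+1%:R ^+ 2 * x)).
have : {ae P, forall w, cvgn (series (f ^~ w))}.
  apply: (@ae_cvg_series _ _ _ _ _ 96).
  - by move=> k w; rewrite mulr_ge0 ?sqr_ge0.
  - by move=> k; exact: integrable_adapted (ft k).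
  - move=> n; apply: (@le_trans _ _ (48 * \sum_(k < n) k.+1%:R ^- 2)); last first.
      have := sum_inv_sqr_le2 R n; lra.
    rewrite mulr_sumr; apply: ler_sum => k _.
    rewrite (expectation_adaptedZ _ (dt k)).
    apply: le_trans (@cube_block_sqr_le R k (k.+1 ^ 3 - k ^ 3) _); last by rewrite subnKC.
    rewrite ler_wpM2l ?sqr_ge0//.
    by have := expectation_Ztot_sqr_le (k ^ 3) (k.+1 ^ 3 - k ^ 3); rewrite subnKC.
apply: filterS => w cw; apply: cvg_along_cubes => // t.
exact: le_trans (Ztot_increment_le t w) (step_size_le t).
Qed.

Lemma ae_deviation_cvg0 i : 0 < alpha ->
  {ae P, forall w, (fun t => deviation i t w) @ \oo --> 0}.
Proof.
move=> alpha0.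
pose f t w := deviation i t w ^+ 2 / (t + (a + b)).+1%:R.
have dt t : adapted t (fun w => deviation i t w ^+ 2).
  exact/(@adapted_fun _ (fun x => x ^+ 2))/adapted_deviation.
have : {ae P, forall w, cvgn (series (f ^~ w))}.
  apply: (@ae_cvg_series _ _ _ _ _ (9 / (2 * alpha))).
  - by move=> k w; rewrite divr_ge0 ?sqr_ge0.
  - move=> t; apply: (@integrable_adapted t).
    exact: (@adapted_fun _ (fun x => x / (t + (a + b)).+1%:R)).
  - move=> n; rewrite ler_pdivlMr ?mulr_gt0// mulr_suml.
    apply: le_trans (sum_expectation_deviation_sqr_le i n).
    rewrite le_eqVlt; apply/orP; left; apply/eqP; apply: eq_bigr => t _.
    under eq_Rintegral do rewrite /f mulrC.
    by rewrite (expectation_adaptedZ _ (dt t)) -/(step_size t); ring.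
apply: filterS => w cw; apply: cvg0_summable_sqr_harmonic cw => t.
exact: deviation_increment_le.
Qed.
End urns.

Unset Implicit Arguments.

Theorem theorem2 (R : realType) (d : measure_display) (T : measurableType d)
    (P : probability T R) (a b N : nat) (alpha : R)
    (U : nat -> nat -> {RV P >-> R}) :
  (1 <= a)%N -> (1 <= b)%N -> (1 <= N)%N ->
  0 < alpha <= 1 ->
  mutually_independent (fun ti : nat * nat => U ti.1 ti.2) ->
  (forall t i : nat, uniform01 (U t i)) ->
  forall i : 'I_N,
    {ae P, forall w : T,
      [/\ cvgn (fun t : nat => Zurn a b alpha U t i w),
          cvgn (fun t : nat => Ztot a b N alpha U t w)
        & limn (fun t : nat => Zurn a b alpha U t i w) =
          limn (fun t : nat => Ztot a b N alpha U t w)]}.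
Proof.
move=> a_gt0 _ N_gt0 /andP[alpha_gt0 alpha_le1] indU unifU i.
have alpha01 : 0 <= alpha <= 1 by rewrite ltW.
have cvgZ := ae_cvg_Ztot b a_gt0 N_gt0 alpha01 indU unifU.
have cvgD := ae_deviation_cvg0 b a_gt0 N_gt0 alpha01 indU unifU i alpha_gt0.
apply: filterS2 cvgZ cvgD => w cZ cD.
have cZi : (fun t => Zurn a b alpha U t i w) @ \oo -->
    limn (fun t => Ztot a b N alpha U t w).
  rewrite -[limn _]addr0 (_ : (fun t => Zurn _ _ _ _ _ _ _) = fun t =>
      Ztot a b N alpha U t w + deviation a b alpha U i t w).
    exact: cvgD cZ cD.
  by apply/funext => t; rewrite /deviation addrC subrK.
split => //; first by apply/cvg_ex; exists (limn (fun t => Ztot a b N alpha U t w)).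
exact: cvg_lim cZi.
Qed.
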